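(* For each integer $k\ge 0$, the polynomial $f_k(t)=\sum_{c\in Odd_k(K)}w(c)\,t^{N(c)}$ is an invariant of virtual knots, i.e. it takes the same value in $\mathbb{Z}[t,t^{-1}]$ on any two equivalent oriented virtual knot diagrams $K$. Consequently the writhe polynomial $W_K(t)=\sum_{k=0}^{\infty}f_k(t)$ is also a virtual knot invariant.
   Context: Virtual knot diagrams are oriented; they have classical (real) crossings and virtual crossings. Two diagrams are equivalent if they are related by a finite sequence of generalized Reidemeister moves: the classical moves $\Omega_1,\Omega_2,\Omega_3$, their virtual versions $\Omega_1',\Omega_2',\Omega_3'$ and the mixed move $\Omega_3^s$ (a strand with only virtual crossings is moved past a classical crossing). The writhe (sign) of a classical crossing $c$ is $w(c)\in\{+1,-1\}$. Gauss diagram: the oriented circle parametrizing the diagram, with one signed arrow for each classical crossing $c$, directed from the preimage of the overcrossing (tail of $c$) to the preimage of the undercrossing (head of $c$), with sign $w(c)$. Crossings and arrows are identified. Index: the endpoints of an arrow $c$ cut the circle into the arc $A$ running, along the orientation, from the tail of $c$ to the head of $c$, and the complementary arc $B$. Two arrows cross if their endpoints interlace. Let $r_{\pm}$ be the number of arrows of sign $\pm1$ that cross $c$ with tail in $A$ and head in $B$, and $l_{\pm}$ the number of arrows of sign $\pm1$ that cross $c$ with tail in $B$ and head in $A$. Then $\mathrm{Ind}(c)=r_+-r_--l_++l_-$. Assigned integer $N(c)$: the endpoints of all arrows divide the circle into arcs. Assign to each such arc the integer obtained as follows: start at a point of the arc, travel once around the circle along the orientation, and take the sum of the signs of all arrows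 whose head is met before their tail. (Passing the tail of an arrow of sign $\varepsilon$ changes this integer by $+\varepsilon$, passing its head changes it by $-\varepsilon$.) If $w(c)=+1$, $N(c)$ is the integer on the arc just before the head of $c$ minus the integer on the arc just before the tail of $c$. If $w(c)=-1$, $N(c)$ is the integer on the arc just after the head of $c$ minus the integer on the arc just after the tail of $c$. For $k\ge0$, $Odd_k(K)$ is the set of classical crossings $c$ of $K$ with $\mathrm{Ind}(c)\equiv 2^k \pmod{2^{k+1}}$. For a given diagram only finitely many $Odd_k(K)$ are nonempty, so $W_K(t)$ is a finite sum. *)

(* Defs.v *)
From HB Require Import structures.
From mathcomp Require Import all_boot all_order all_algebra finmap.
From mathcomp Require Import monalg.
From mathcomp Require Import boolp classical_sets cardinality fsbigop.
From mathcomp Require Import zify.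
From Stdlib Require Import Relations.

Set Implicit Arguments.
Unset Strict Implicit.
Unset Printing Implicit Defensive.

Import GRing.Theory Num.Theory.

Local Open Scope ring_scope.

(** * Oriented virtual knot diagrams

    A diagram is an oriented generic closed curve whose double points carry
    over/under information (classical crossings) or none (virtual crossings).
    It is recorded by the cyclic word of the passages through its crossings
    met when travelling once along the curve; every crossing, virtual or
    classical, is passed twice.  For a virtual passage the word also records on
    which side the other strand arrives; for a classical passage this follows
    from the sign.  Together these data determine the curve on the oriented
    sphere up to orientation-preserving homeomorphism: its regions are the
    orbits of [turn] below, and a word comes from a curve on the sphere exactly
    when V - E + F = 2.  A planar diagram is a spherical one with a chosen
    unbounded region, and planar moves are spherical moves. *)

(** [Over e] and [Under e]: passage through a classical crossing of sign [+1]
    if [e], [-1] otherwise.  [Virt b]: passage through a virtual crossing,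
    where [b] says that the other strand crosses from right to left. *)
Inductive passage := Over of bool | Under of bool | Virt of bool.

Definition passage_code p : bool + bool + bool :=
  match p with
  | Over e => inl (inl e) | Under e => inl (inr e) | Virt b => inr b
  end.
Definition passage_decode c : passage :=
  match c with
  | inl (inl e) => Over e | inl (inr e) => Under e | inr b => Virt b
  end.
Lemma passage_codeK : cancel passage_code passage_decode.
Proof. by case. Qed.
HB.instance Definition _ := Countable.copy passage (can_type passage_codeK).

(** The passage of the other strand through the same crossing. *)
Definition partner p :=
  match p with Over e => Under e | Under e => Over e | Virt b => Virt (~~ b) end.

(** The crossing of the same kind seen in a mirror: opposite sign, or the other
    strand arriving from the opposite side. *)
Definition flip p :=
  match p with
  | Over e => Over (~~ e) | Under e => Under (~~ e) | Virt b => Virt (~~ b)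
  end.

(** Does the other strand cross from right to left?  At a positive crossing
    the directions (over, under) form a positive basis of the plane. *)
Definition from_right p :=
  match p with Over e => e | Under e => ~~ e | Virt b => b end.

Definition classical p := if p is Virt _ then false else true.

(** A letter is a crossing name with a passage through that crossing. *)
Definition letter := (nat * passage)%type.
Definition word := seq letter.

Definition opposite (l : letter) : letter := (l.1, partner l.2).

Definition well_formed (w : word) :=
  all (fun l : letter =>
         (count (fun m : letter => m.1 == l.1) w == 2%N) && (opposite l \in w)) w.

(** A dart [(l, b)] leaves the passage [l] along the curve, forwards if [b] and
    backwards otherwise.  [turn w] follows a dart to the next passage and turns
    left there, so that it walks around the region to the left of the dart. *)
Definition dart := (letter * bool)%type.

Definition darts (w : word) : seq dart :=
  [seq (l, b) | l <- w, b <- [:: true; false]].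

Definition turn (w : word) (d : dart) : dart :=
  let l := if d.2 then next w d.1 else prev w d.1 in
  (opposite l, d.2 == from_right l.2).

(** [F] lists the regions.  There are V = size w / 2 crossings and E = 2 V
    edges, so that the sphere has F = V + 2 regions; the circle without
    crossings, which has no darts, is set apart. *)
Definition planar (w : word) : Prop :=
  w = [::] \/
  exists F : seq (seq dart),
    [/\ [::] \notin F, all (fcycle (turn w)) F,
        perm_eq (flatten F) (darts w) & size F = ((size w)./2 + 2)%N].

Record diagram := Diagram {
  code :> word;
  code_well_formed : well_formed code;
  code_planar : planar code
}.

(** * Generalized Reidemeister moves *)

(** A local picture before and after a move: for each strand, the passages met
    along it on both sides of the move. *)
Definition tangle_move := seq (word * word).

Definition strand (o : bool) (l m : letter) : word :=
  if o then [:: l; m] else [:: m; l].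

(** The two strands of a bigon, with crossings [x] and [y]; the second strand
    has the direction of the first one iff [o]. *)
Definition bigon (x y : nat) (p : passage) (o : bool) : tangle_move :=
  [:: ([::], [:: (x, p); (y, flip p)]);
      ([::], strand o (x, partner p) (y, partner (flip p)))].

(** Three strands 1, 2, 3 with crossings [x] = 12, [y] = 13 and [z] = 23, where
    [px], [py] are the passages of strand 1 through [x], [y], and [pz] is the
    passage of strand 2 through [z].  The bits [o1], [o2], [o3] tell whether
    x precedes y on strand 1, x precedes z on strand 2, y precedes z on
    strand 3.  The move reverses all three. *)
Definition triangle (x y z : nat) (px py pz : passage) (o1 o2 o3 : bool) :
    tangle_move :=
  let s1 o := strand o (x, px) (y, py) in
  let s2 o := strand o (x, partner px) (z, pz) in
  let s3 o := strand o (y, partner py) (z, partner pz) in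
  [:: (s1 o1, s1 (~~ o1)); (s2 o2, s2 (~~ o2)); (s3 o3, s3 (~~ o3))].

(** The three crossings bound a triangular region: each of them lies on a well
    defined side of the strand opposite to it.  For instance [z] lies to the
    left of strand 1 when, at [x], strand 2 leads from right to left towards
    [z] or from left to right away from [z]; and likewise, at [y], strand 3. *)
Definition triangular (px py pz : passage) (o1 o2 o3 : bool) :=
  [&& (from_right px == o2) == (from_right py == o3),
      (from_right (partner px) == o1) == (from_right pz == ~~ o3)
    & (from_right (partner py) == ~~ o1) == (from_right (partner pz) == ~~ o2)].

(** In [Omega3], strand 1 is over strand 2, which is over strand 3; in
    [Omega3s], strand 1 has only virtual crossings, and strand 2 is over
    strand 3.  As the strands may be listed in any order (see [step]), this
    loses no generality. *)
Inductive reidemeister : tangle_move -> Prop :=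
| Omega1 x p of classical p :
    reidemeister [:: ([::], [:: (x, p); (x, partner p)])]
| Omega1' x b :
    reidemeister [:: ([::], [:: (x, Virt b); (x, partner (Virt b))])]
| Omega2 x y e o : reidemeister (bigon x y (Over e) o)
| Omega2' x y b o : reidemeister (bigon x y (Virt b) o)
| Omega3 x y z e1 e2 e3 o1 o2 o3
    of triangular (Over e1) (Over e2) (Over e3) o1 o2 o3 :
    reidemeister (triangle x y z (Over e1) (Over e2) (Over e3) o1 o2 o3)
| Omega3' x y z b1 b2 b3 o1 o2 o3
    of triangular (Virt b1) (Virt b2) (Virt b3) o1 o2 o3 :
    reidemeister (triangle x y z (Virt b1) (Virt b2) (Virt b3) o1 o2 o3)
| Omega3s x y z b1 b2 e3 o1 o2 o3
    of triangular (Virt b1) (Virt b2) (Over e3) o1 o2 o3 :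
    reidemeister (triangle x y z (Virt b1) (Virt b2) (Over e3) o1 o2 o3).

(** The word in which the given strands are separated by the given gaps. *)
Definition join (strands gaps : seq word) : word :=
  flatten [seq s.1 ++ s.2 | s <- zip strands gaps].

(** [Rotate] and [Rename] change only the base point and the names of the
    crossings.  In [Move], both ends are diagrams by assumption, so that new
    crossings have fresh names and a new bigon is a region of a planar
    curve. *)
Inductive step (D D' : diagram) : Prop :=
| Rotate n of D' = rot n (code D) :> word
| Rename (h : nat -> nat) of injective h
    & D' = [seq (h l.1, l.2) | l <- code D] :> word
| Move (T T' : tangle_move) (gaps : seq word)
    of reidemeister T & perm_eq T T' & size gaps = size T
    & D = join (unzip1 T') gaps :> word & D' = join (unzip2 T') gaps :> word.

Definition equivalent : diagram -> diagram -> Prop :=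
  clos_refl_sym_trans diagram step.

(** * Gauss diagrams *)

(** The endpoints of the arrows, in their order on the circle cut at the base
    point: [Over] is a tail, [Under] is a head. *)
Definition gauss (w : word) : word := [seq l <- w | classical l.2].

(** An arrow is the name of a classical crossing with its sign. *)
Definition arrow := (nat * bool)%type.
Definition arrow_tail (c : arrow) : letter := (c.1, Over c.2).
Definition arrow_head (c : arrow) : letter := (c.1, Under c.2).
Definition writhe (c : arrow) : int := if c.2 then 1 else -1.

Definition arrows (w : word) : seq arrow :=
  pmap (fun l : letter => if l.2 is Over e then Some (l.1, e) else None) w.

(** The open arc from the endpoint [l] to the endpoint [m]. *)
Definition open_arc (g : word) (l m : letter) : word := behead (arc g l m).

(** The number of arrows of sign [e] with tail in [A] and head in [B]. *)
Definition crossing_arrows (g : word) (e : bool) (A B : word) : nat :=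
  count (fun d => [&& d.2 == e, arrow_tail d \in A & arrow_head d \in B])
    (arrows g).

Definition index_arrow (g : word) (c : arrow) : int :=
  let A := open_arc g (arrow_tail c) (arrow_head c) in
  let B := open_arc g (arrow_head c) (arrow_tail c) in
  let r e := (crossing_arrows g e A B)%:Z in
  let l e := (crossing_arrows g e B A)%:Z in
  r true - r false - l true + l false.

(** The integer assigned to the arc containing the base point of [g]. *)
Definition arc_value (g : word) : int :=
  \sum_(d <- arrows g
         | (index (arrow_head d) g < index (arrow_tail d) g)%N) writhe d.

Definition value_before (g : word) (l : letter) : int :=
  arc_value (rot (index l g) g).
Definition value_after (g : word) (l : letter) : int :=
  arc_value (rot (index l g).+1 g).

Definition assigned_integer (g : word) (c : arrow) : int :=
  if c.2 then value_before g (arrow_head c) - value_before g (arrow_tail c)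
  else value_after g (arrow_head c) - value_after g (arrow_tail c).

(** * The polynomials *)

Definition Odd (k : nat) (D : diagram) : seq arrow :=
  let g := gauss D in
  [seq c <- arrows g | (index_arrow g c == 2 ^+ k %[mod 2 ^+ k.+1])%Z].

(** Z[t, t^-1] as the free abelian group on the powers of t, indexed by their
    exponents in Z; [<< a *g n >>] is the monomial a t^n. *)
Definition laurent := {malg int[int]}.

Definition f_poly (k : nat) (D : diagram) : laurent :=
  \sum_(c <- Odd k D) << writhe c *g assigned_integer (gauss D) c >>.

Definition writhe_polynomial (D : diagram) : laurent :=
  \sum_(k \in [set: nat]) f_poly k D.

(** The sum defining [writhe_polynomial] is finite. *)
Lemma Odd_eq0 (D : diagram) (k : nat) :
  (2 * size (arrows (gauss D)) <= k)%N -> Odd k D = [::].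
Proof.
move=> le_k; apply/eqP; rewrite -[_ == _]negbK -has_filter; apply/negP.
case/hasP=> c _; rewrite eqz_mod_dvd => /dvdzP[q E].
have {}E : index_arrow (gauss D) c = (2 * q + 1) * 2 ^+ k.
  by rewrite mulrDl mul1r -[LHS](subrK (2 ^+ k)) E exprS mulrA [q * 2]mulrC.
have nz : 2 * q + 1 != 0 by lia.
have lo : (2 ^ k <= `|index_arrow (gauss D) c|)%N.
  rewrite E abszM abszX leq_pmull // absz_gt0 //.
have hi : (`|index_arrow (gauss D) c| <= 2 * size (arrows (gauss D)))%N.
  rewrite /index_arrow /crossing_arrows; move: (open_arc _ _ _) => A.
  move: (open_arc _ _ _) => B.
  set s := arrows _; set a := count _ s; set b := count _ s.
  set a' := count _ s; set b' := count _ s.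
  have [ha hb] : (a <= size s)%N /\ (b <= size s)%N by rewrite !count_size.
  have [ha' hb'] : (a' <= size s)%N /\ (b' <= size s)%N by rewrite !count_size.
  by lia.
by have := leq_trans (leq_trans lo hi) le_k; rewrite leqNgt ltn_expl.
Qed.

Lemma finite_support_f_poly (D : diagram) : finite_set [set k | f_poly k D != 0].
Proof.
apply: (sub_finite_set _ (finite_II (2 * size (arrows (gauss D))))) => k /=.
apply: contra_neqT; rewrite -leqNgt => /Odd_eq0; rewrite /f_poly => ->.
by rewrite big_nil.
Qed.

(* Main.v *)
(** Give each letter of the cyclic word its height: the sum of the signs of the
    tails minus the signs of the heads passed before it.  Arrows with both ends
    in an arc cancel there, so Ind(c) = height(head) - height(tail) - w(c), and
    the arc integers differ from the heights by a constant, so N(c) = Ind(c) + 1.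
    Hence f_k is a sum over the arrows of psi (w c) (Ind c), where psi is odd in
    the sign and vanishes at index 0 because 2^k is not 0 modulo 2^(k+1).  Any
    such sum is invariant: the strands of a move have the same total weight
    before and after, so the heights of all letters outside are unchanged; the
    arrow of a kink has index 0; the two arrows of a bigon have equal indices
    and opposite signs; and for a triangle the condition [triangular] says
    exactly that each of the three indices is unchanged. *)

Require Import Defs.
From mathcomp Require Import all_boot all_order all_algebra.
From mathcomp Require Import monalg.
From mathcomp Require Import classical_sets fsbigop.
From mathcomp Require Import zify.

Set Implicit Arguments.
Unset Strict Implicit.
Unset Printing Implicit Defensive.

Import GRing.Theory Num.Theory.

Local Open Scope ring_scope.

(** * Weights and heights along a word *)

Definition weight (l : letter) : int :=
  match l.2 with
  | Over e => writhe (l.1, e)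
  | Under e => - writhe (l.1, e)
  | Virt _ => 0
  end.

Definition total (w : word) : int := \sum_(l <- w) weight l.

Definition height (w : word) (l : letter) : int := total (take (index l w) w).

(** The last term removes the tail of [c] itself. In a word of total 0 this is the total of the open
    arc from tail to head, even when that arc contains the base point. *)
Definition height_index (w : word) (c : arrow) : int :=
  height w (arrow_head c) - height w (arrow_tail c) - writhe c.

Lemma total_nil : total [::] = 0.
Proof. exact: big_nil. Qed.

Lemma total_cons l w : total (l :: w) = weight l + total w.
Proof. exact: big_cons. Qed.

Lemma total_cat u v : total (u ++ v) = total u + total v.
Proof. exact: big_cat. Qed.

(** Virtual letters weigh 0, so deleting them changes no prefix total. *)
Lemma height_gauss w l : classical l.2 -> height (gauss w) l = height w l.
Proof.
move=> cl; rewrite /height; elim: w => //= m w IH.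
have [cm|] := ifP; rewrite /= eq_sym; have [<-|ne] //= := eqVneq l m.
- by rewrite !total_cons IH.
- by rewrite cl.
rewrite total_cons -IH => nc; suff -> : weight m = 0 by rewrite add0r.
by move: nc; rewrite /weight; case: (m.2).
Qed.

Lemma mem_arrows w c : (c \in arrows w) = (arrow_tail c \in w).
Proof.
elim: w => //= -[x p] w IH; rewrite in_cons -IH.
case: c {IH} => y e'; rewrite /arrow_tail xpair_eqE /=.
case: p => [e|e|b] /=; try by rewrite andbF.
by rewrite in_cons xpair_eqE; congr ((_ && _) || _); case: e e' => -[].
Qed.

Lemma arrows_gauss w : arrows (gauss w) = arrows w.
Proof. by elim: w => //= -[x [e|e|b]] w IH //=; rewrite IH. Qed.

Lemma sum_tails (V : nmodType) (F : letter -> V) w :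
  (forall l, ~~ (if l.2 is Over _ then true else false) -> F l = 0) ->
  \sum_(l <- w) F l = \sum_(c <- arrows w) F (arrow_tail c).
Proof.
move=> F0; elim: w => [|[x p] w IH]; first by rewrite !big_nil.
rewrite big_cons IH; case: p => [e|e|b] /=; last 2 first.
- by rewrite F0 // add0r.
- by rewrite F0 // add0r.
by rewrite big_cons.
Qed.

(** * Gauss words *)

Lemma opposite_neq l : opposite l != l.
Proof. by case: l => x [[]|[]|[]]; apply/eqP => -[]. Qed.

(** A letter and its opposite are distinct and share a name that occurs exactly twice, so neither is
    repeated. *)
Lemma well_formed_uniq w : well_formed w -> uniq w.
Proof.
move=> /allP wf; apply: count_mem_uniq => l.
have [lw|/count_memPn //] := boolP (l \in w).
have /andP[/eqP c2 ow] := wf _ lw.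
have := count_predUI (pred1 l) (pred1 (opposite l)) w.
have -> : count (predI (pred1 l) (pred1 (opposite l))) w = 0%N.
  rewrite -(count_pred0 w); apply: eq_count => m /=.
  by apply/negP => /andP[/eqP-> /eqP/esym/eqP]; apply/negP/opposite_neq.
have : (count (predU (pred1 l) (pred1 (opposite l))) w <= 2)%N.
  by rewrite -c2; apply: sub_count => m /orP[] /eqP->.
have : (0 < count_mem l w)%N by rewrite -has_count has_pred1.
have : (0 < count_mem (opposite l) w)%N by rewrite -has_count has_pred1.
lia.
Qed.

Definition gauss_word (g : word) :=
  [/\ uniq g, all (fun l => classical l.2) g
    & {in g, forall l, opposite l \in g}].

Lemma gauss_word_gauss w : well_formed w -> gauss_word (gauss w).
Proof.
move=> wf; split; first exact/filter_uniq/well_formed_uniq.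
  exact: filter_all.
move=> l; rewrite !mem_filter => /andP[cl lw].
have /andP[_ ->] := allP wf _ lw; rewrite andbT.
by case: l cl {lw} => x [].
Qed.

Lemma perm_gauss_word g g' : perm_eq g g' -> gauss_word g -> gauss_word g'.
Proof.
move=> p [u c o]; split; first by rewrite -(perm_uniq p).
  by rewrite -(perm_all _ p).
by move=> l; rewrite -!(perm_mem p); apply: o.
Qed.

Lemma arrow_tail_inj : injective arrow_tail.
Proof. by case=> x e [y e'] [-> ->]. Qed.

Lemma arrow_head_inj : injective arrow_head.
Proof. by case=> x e [y e'] [-> ->]. Qed.

Lemma arrow_tail_neq_head c d : arrow_tail c != arrow_head d.
Proof. by apply/eqP. Qed.

Lemma map_tail_arrows w :
  map arrow_tail (arrows w) =
  [seq l <- w | if l.2 is Over _ then true else false].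
Proof. by elim: w => //= -[x [e|e|b]] w IH //=; rewrite IH. Qed.

Lemma uniq_arrows w : uniq w -> uniq (arrows w).
Proof.
by move=> u; rewrite -(map_inj_uniq arrow_tail_inj) map_tail_arrows filter_uniq.
Qed.

Lemma mem_arrows_head g c :
  gauss_word g -> (c \in arrows g) = (arrow_head c \in g).
Proof.
by case=> _ _ o; rewrite mem_arrows; apply/idP/idP => /o.
Qed.

Lemma perm_arrow_ends g : gauss_word g ->
  perm_eq g (map arrow_tail (arrows g) ++ map arrow_head (arrows g)).
Proof.
move=> gg; have [u c o] := gg; apply: uniq_perm => //.
  rewrite cat_uniq !map_inj_uniq ?uniq_arrows //=;
    [|exact: arrow_head_inj|exact: arrow_tail_inj].
  rewrite andbT; apply/hasPn => _ /mapP[d _ ->]; apply/mapP => -[d' _] /esym/eqP.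
  by apply/negP/arrow_tail_neq_head.
case=> x p; rewrite mem_cat; apply/idP/idP => [lg|/orP[]/mapP[d dg ->]].
- case: p lg => [e|e|b] lg.
  + by rewrite (map_f arrow_tail (x := (x, e))) // mem_arrows.
  + by rewrite (map_f arrow_head (x := (x, e))) ?orbT // mem_arrows_head.
  + by have := allP c _ lg.
- by rewrite -mem_arrows.
- by rewrite -mem_arrows_head.
Qed.

Lemma sum_gauss_word (V : nmodType) (F : letter -> V) g : gauss_word g ->
  \sum_(l <- g) F l = \sum_(c <- arrows g) (F (arrow_tail c) + F (arrow_head c)).
Proof.
by move/perm_arrow_ends => /(perm_big _) ->; rewrite big_cat !big_map big_split.
Qed.

(** * Heights, arc integers and indices under a change of base point *)

Lemma weight_tail c : weight (arrow_tail c) = writhe c.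
Proof. by case: c. Qed.

Lemma weight_head c : weight (arrow_head c) = - writhe c.
Proof. by case: c. Qed.

Lemma total_gauss_word g : gauss_word g -> total g = 0.
Proof.
move/sum_gauss_word; rewrite /total => ->.
by rewrite big1 // => c _; rewrite weight_tail weight_head subrr.
Qed.

(** Letters of [b] lose the prefix [a]; letters of [a] gain the prefix [b], of total [- total a]. *)
Lemma height_cat_swap a b l : gauss_word (a ++ b) -> l \in a ++ b ->
  height (b ++ a) l = height (a ++ b) l - total a.
Proof.
move=> gg; have [u _ _] := gg.
have t0 := total_gauss_word gg; rewrite total_cat in t0.
move: u; rewrite cat_uniq mem_cat => /and3P[_ /hasPn dis _].
rewrite /height !index_cat.
have [la|lNa] /= := boolP (l \in a) => [_|lb].
  have -> : (l \in b) = false by apply/negP => /dis; rewrite /= la.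
  rewrite !take_cat ltnNge leq_addr /= addKn index_mem la total_cat; lia.
rewrite lb !take_cat index_mem lb ltnNge leq_addr /= addKn total_cat; lia.
Qed.

Lemma height_index_cat_swap a b c :
  gauss_word (a ++ b) -> c \in arrows (a ++ b) ->
  height_index (b ++ a) c = height_index (a ++ b) c.
Proof.
move=> gg cg; have := cg; rewrite mem_arrows => tg.
have := cg; rewrite mem_arrows_head // => hg.
rewrite /height_index (height_cat_swap gg tg) (height_cat_swap gg hg); lia.
Qed.

Lemma height_index_rot n g c : gauss_word g -> c \in arrows g ->
  height_index (rot n g) c = height_index g c.
Proof.
by move=> gg cg; rewrite -[in RHS](cat_take_drop n g) /rot
  height_index_cat_swap ?cat_take_drop.
Qed.

(** Only the arrow with end [l] has its two ends reordered: it enters the sum if [l] is its tail and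
    leaves it if [l] is its head. *)
Lemma arc_value_rot1 l q : gauss_word (l :: q) ->
  arc_value (rcons q l) = arc_value (l :: q) + weight l.
Proof.
move=> gg; have [u _ o] := gg.
have p : perm_eq (arrows (rcons q l)) (arrows (l :: q)).
  by apply: perm_pmap; rewrite perm_rcons.
rewrite /arc_value (perm_big _ p) [LHS]big_mkcond [X in X + _]big_mkcond.
(* As a sum over all letters, the weight can be regrouped and compared arrow by arrow. *)
have -> : weight l = \sum_(m <- l :: q) if m == l then weight m else 0.
  rewrite big_cons eqxx big1_seq ?addr0 // => m mq.
  by case: eqP mq u => // -> /= ->.
rewrite (sum_gauss_word _ gg) -big_split; apply: eq_big_seq => d dg.
have := dg; rewrite mem_arrows in_cons => tg.
have := dg; rewrite mem_arrows_head // in_cons => hg.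
rewrite -cats1 !index_cat /= ![l == _]eq_sym weight_tail weight_head.
move: u => /= /andP[lq _].
have [tl|tl] := eqVneq (arrow_tail d) l.
  have hl : arrow_head d != l by rewrite -tl eq_sym arrow_tail_neq_head.
  move: hg; rewrite (negPf hl) /= => hg.
  by rewrite hg tl (negPf lq) addn0 index_mem hg /= ?eqxx add0r addr0.
move: tg; rewrite (negPf tl) /= => tg; rewrite tg.
have [hl|hl] := eqVneq (arrow_head d) l.
  have := tg; rewrite -index_mem => ti.
  by rewrite hl (negPf lq) addn0 ltnNge (ltnW ti) /= ?eqxx sub0r subrr.
by move: hg; rewrite (negPf hl) /= => ->; rewrite ltnS !addr0.
Qed.

Lemma arc_value_cat_swap a b : gauss_word (a ++ b) ->
  arc_value (b ++ a) = arc_value (a ++ b) + total a.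
Proof.
elim: a b => [|l a IH] b gg; first by rewrite cats0 total_nil addr0.
rewrite -cat_rcons IH -rcons_cat.
  by rewrite (arc_value_rot1 gg) total_cons addrA.
by apply: perm_gauss_word gg; rewrite perm_sym perm_rcons.
Qed.

Lemma arc_value_rot n g : gauss_word g ->
  arc_value (rot n g) = arc_value g + total (take n g).
Proof.
by move=> gg; rewrite /rot arc_value_cat_swap cat_take_drop.
Qed.

Lemma total_take_indexS g l : l \in g ->
  total (take (index l g).+1 g) = height g l + weight l.
Proof.
move=> lg; rewrite (take_nth l) ?index_mem // nth_index // -cats1 total_cat.
by rewrite total_cons total_nil addr0.
Qed.

(** Arc integers before letters are heights up to a constant. For sign +1, N is the height
    difference, that is, the index plus 1; for sign -1 the weights of the two ends add 2 to that
    difference, which is the index minus 1. *)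
Lemma assigned_integerE g c : gauss_word g -> c \in arrows g ->
  assigned_integer g c = height_index g c + 1.
Proof.
move=> gg cg; have := cg; rewrite mem_arrows => tg.
have := cg; rewrite mem_arrows_head // => hg.
rewrite /assigned_integer /value_before /value_after /height_index.
rewrite !arc_value_rot // !total_take_indexS // weight_tail weight_head.
rewrite -!/(height _ _).
rewrite /writhe; case: c.2; lia.
Qed.

Lemma countZ (T : Type) (a : pred T) s :
  (count a s)%:Z = \sum_(x <- s) (a x)%:Z.
Proof.
elim: s => [|x s IH]; first by rewrite big_nil.
by rewrite big_cons -IH /= PoszD.
Qed.

(** With the base point at the tail, [height_index] is the total of the open arc [A]. An arrow with
    both ends in [A] cancels there; one with a single end in [A] crosses [c] and contributes its
    sign for a tail, the opposite for a head. *)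
Lemma index_arrowE g c : gauss_word g -> c \in arrows g ->
  index_arrow g c = height_index g c.
Proof.
move=> gg cg; have [u _ _] := gg; have := cg; rewrite mem_arrows => tg.
have := cg; rewrite mem_arrows_head // => hg.
have nth := arrow_tail_neq_head c c.
rewrite /index_arrow /open_arc.
have [i A B <- <- E] := rot_to_arc u tg hg nth; rewrite /=.
rewrite -(height_index_rot i gg cg) E.
have pE : perm_eq (rot i g) g by rewrite perm_rot.
have := u; rewrite -(perm_uniq pE) E /= mem_cat in_cons cat_uniq !negb_or /=.
move=> /andP[/and3P[tA _ tB] /and3P[uA /andP[hA /hasPn dAB] _]].
have -> : height_index (arrow_tail c :: A ++ arrow_head c :: B) c = total A.
  rewrite /height_index /height /= eqxx (negPf nth) take0 total_nil total_cons.
  rewrite index_cat (negPf hA) /= eqxx addn0.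
  rewrite -[X in _ + total X]/(take (size A) (A ++ arrow_head c :: B)).
  rewrite take_size_cat // weight_tail; lia.
have -> : total A = \sum_(l <- g) if l \in A then weight l else 0.
  rewrite -(perm_big _ pE) -big_mkcond -big_filter /=; apply: perm_big.
  apply: uniq_perm => //; first by rewrite filter_uniq // (perm_uniq pE).
  move=> l; rewrite mem_filter E in_cons mem_cat.
  by case: (l \in A); rewrite ?orbT.
rewrite (sum_gauss_word _ gg) /crossing_arrows !countZ.
rewrite -!sumrB -big_split /=; apply: eq_big_seq => d dg.
(* Away from the ends of [c] the arcs are complementary, so all four counts reduce to membership in
   [A]. *)
have part l : l \in g -> l != arrow_tail c -> l != arrow_head c ->
    (l \in B) = (l \notin A).
  move=> lg /negPf lt /negPf lh; move: lg.
  rewrite -(perm_mem pE) E in_cons mem_cat in_cons lt lh /=.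
  case: (boolP (l \in A)) => lA /=; last by move=> ->.
  by move=> _; apply/negP => /dAB; rewrite /= lA.
rewrite weight_tail weight_head /writhe.
have [->|dc] := eqVneq d c.
  by rewrite (negPf tA) (negPf tB) !andbF (negPf hA) /=; case: c.2.
have -> : (arrow_tail d \in B) = (arrow_tail d \notin A).
  apply: part; rewrite -?mem_arrows ?(inj_eq arrow_tail_inj) //.
  exact: arrow_tail_neq_head.
have -> : (arrow_head d \in B) = (arrow_head d \notin A).
  apply: part; rewrite -?mem_arrows_head ?(inj_eq arrow_head_inj) //.
  by rewrite eq_sym arrow_tail_neq_head.
by case: d.2; case: (_ \in A); case: (_ \in A).
Qed.

(** * Decorated letters *)

(** Unlike heights looked up in a word, decorated letters do not depend on the
    rest of the word, so that the two sides of a move can be compared strand by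
    strand and up to permutation. *)
Fixpoint decorate (a : int) (w : word) : seq (letter * int) :=
  if w is l :: w' then (l, a) :: decorate (a + weight l) w' else [::].

Lemma decorate_cat a u v :
  decorate a (u ++ v) = decorate a u ++ decorate (a + total u) v.
Proof.
elim: u a => [|l u IH] a /=; first by rewrite total_nil addr0.
by rewrite IH total_cons addrA.
Qed.

Lemma unzip1_decorate a w : unzip1 (decorate a w) = w.
Proof. by elim: w a => //= l w IH a; rewrite IH. Qed.

Lemma decorateE a w : uniq w ->
  decorate a w = [seq (l, a + height w l) | l <- w].
Proof.
elim: w a => //= l w IH a /andP[lw u].
rewrite {1}/height /= eqxx total_nil addr0 IH //; congr cons.
apply/eq_in_map => m mw; have lm : (l == m) = false.
  by apply: contraNF lw => /eqP->.
by rewrite /height /= lm total_cons addrA.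
Qed.

(** The direction [o] passes from the order of the letters into their heights. *)
Lemma perm_decorate_strand a o l m :
  perm_eq (decorate a (strand o l m))
    [:: (l, a + if o then 0 else weight m); (m, a + if o then weight l else 0)].
Proof. by case: o; rewrite /= addr0 // (perm_catC [:: _] [:: _]). Qed.

(** * Arrow sums as double sums over decorated letters *)

Section GaussSum.

Variables (V : zmodType) (psi : bool -> int -> V).

(** Testing all pairs replaces looking up the head of each tail, so the sum depends on the decorated
    letters only up to order. *)
Definition arrow_term (u h : letter * int) : V :=
  match u.1.2, h.1.2 with
  | Over e, Under e' =>
    if (u.1.1 == h.1.1) && (e == e')
    then psi e (h.2 - u.2 - writhe (u.1.1, e)) else 0
  | _, _ => 0
  end.

Definition pair_sum (M N : seq (letter * int)) : V :=
  \sum_(u <- M) \sum_(h <- N) arrow_term u h.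

Definition gauss_sum M := pair_sum M M.

Lemma perm_gauss_sum M N : perm_eq M N -> gauss_sum M = gauss_sum N.
Proof.
move=> p; rewrite /gauss_sum /pair_sum (perm_big _ p).
by apply: eq_bigr => u _; rewrite (perm_big _ p).
Qed.

Lemma pair_sum_eq0 M N :
  (forall u h, u \in M -> h \in N -> u.1.1 != h.1.1) -> pair_sum M N = 0.
Proof.
move=> dis; rewrite /pair_sum big1_seq // => u /= uM.
rewrite big1_seq // => h /= hN; rewrite /arrow_term (negPf (dis _ _ uM hN)).
by case: u.1.2 => //; case: h.1.2.
Qed.

Lemma gauss_sum_cat M N :
  (forall u h, u \in M -> h \in N -> u.1.1 != h.1.1) ->
  gauss_sum (M ++ N) = gauss_sum M + gauss_sum N.
Proof.
move=> dis; have MN := pair_sum_eq0 dis.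
have NM : pair_sum N M = 0.
  by apply: pair_sum_eq0 => u h uN hM; rewrite eq_sym dis.
rewrite {1}/gauss_sum /pair_sum big_cat /=.
under eq_bigr do rewrite big_cat /=.
under [X in _ + X]eq_bigr do rewrite big_cat /=.
rewrite !big_split /= -/(pair_sum M N) -/(pair_sum N M) MN NM.
by rewrite addr0 add0r.
Qed.

Definition arrow_sum (g : word) : V :=
  \sum_(c <- arrows g) psi c.2 (height_index g c).

(** Each tail meets exactly one matching head: the opposite letter is present, and no letter is
    repeated. *)
Lemma gauss_sum_arrows w : well_formed w ->
  gauss_sum (decorate 0 w) = arrow_sum (gauss w).
Proof.
move=> wf; have u := well_formed_uniq wf.
rewrite /arrow_sum /gauss_sum /pair_sum decorateE // big_map sum_tails; last first.
  by move=> [x [e|e|b]] //= _; rewrite big1.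
rewrite arrows_gauss; apply: eq_big_seq => -[x e] cw.
have hw : arrow_head (x, e) \in w.
  by move: cw; rewrite mem_arrows => /(allP wf)/andP[].
rewrite big_map (bigD1_seq (arrow_head (x, e))) //= big1 ?addr0 => [|h hh].
  rewrite /arrow_term /= !eqxx /= !add0r /height_index !height_gauss //.
rewrite /arrow_term /=; case: h hh => y [e'|e'|b] //= hh.
case: eqP => //= xy; case: eqP => //= ee.
by move: hh; rewrite xy ee /arrow_head eqxx.
Qed.

End GaussSum.

(** * Moves *)

(** An entry of [U] is a strand before and after the move with its starting height, common to both
    sides. *)
Definition strands_before (U : seq (int * (word * word))) : seq (letter * int) :=
  flatten [seq decorate u.1 u.2.1 | u <- U].

Definition strands_after (U : seq (int * (word * word))) : seq (letter * int) :=
  flatten [seq decorate u.1 u.2.2 | u <- U].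

Lemma unzip1_strands_before U :
  unzip1 (strands_before U) = flatten (unzip1 (unzip2 U)).
Proof.
elim: U => //= u U IH; rewrite /strands_before /= [unzip1 _]map_cat.
by rewrite -/(unzip1 _) unzip1_decorate -IH.
Qed.

Lemma unzip1_strands_after U :
  unzip1 (strands_after U) = flatten (unzip2 (unzip2 U)).
Proof.
elim: U => //= u U IH; rewrite /strands_after /= [unzip1 _]map_cat.
by rewrite -/(unzip1 _) unzip1_decorate -IH.
Qed.

(** As each strand keeps its total, every gap and every later strand starts at the same height on
    both sides; [M] collects the decorated gaps. *)
Lemma decorate_join a (T : tangle_move) gaps : size gaps = size T ->
  {in T, forall t, total t.1 = total t.2} ->
  exists U, unzip2 U = T /\ exists M,
    perm_eq (decorate a (join (unzip1 T) gaps)) (M ++ strands_before U) /\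
    perm_eq (decorate a (join (unzip2 T) gaps)) (M ++ strands_after U).
Proof.
elim: T gaps a => [|[s s'] T IH] [|g gaps] a //= => [_ _|[sz] eqT].
  by exists [::]; split=> //; exists [::].
have [|U [<- [M [p p']]]] := IH gaps (a + total s + total g) sz.
  by move=> t tT; apply: eqT; rewrite in_cons tT orbT.
have es := eqT _ (mem_head _ _).
exists ((a, (s, s')) :: U); split=> //.
exists (decorate (a + total s) g ++ M).
have arrange x y (m z j : seq (letter * int)) : perm_eq j (m ++ z) ->
    perm_eq ((x ++ y) ++ j) ((y ++ m) ++ x ++ z).
  by move=> jz; rewrite -!catA perm_catCA perm_cat2l perm_sym perm_catCA
    perm_cat2l perm_sym.
rewrite /join /= !decorate_cat /=; split.
  by apply: arrange; rewrite total_cat addrA; exact: p.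
by rewrite -es; apply: arrange; rewrite total_cat addrA -es; exact: p'.
Qed.

(** Carries the starting heights along when the strands of a [Move] are reordered. *)
Lemma perm_unzip2 (S T : eqType) (U : seq (S * T)) t : perm_eq t (unzip2 U) ->
  exists2 U', unzip2 U' = t & perm_eq U U'.
Proof.
case: U => [|u0 U] p; first by exists [::] => //; apply/esym/perm_nilP.
have /(perm_iotaP u0.2)[Is pI ->] := p.
exists [seq nth u0 (u0 :: U) i | i <- Is].
  rewrite /unzip2 -map_comp; apply/eq_in_map => i iI /=.
  rewrite -[u0.2 :: _]/(unzip2 (u0 :: U)) (nth_map u0) //.
  by move: iI; rewrite (perm_mem pI) mem_iota size_map.
by rewrite perm_sym; apply/(perm_iotaP u0); exists Is; rewrite // -(size_map snd).
Qed.

Lemma total_strand o l m : total (strand o l m) = weight l + weight m.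
Proof. by case: o; rewrite !total_cons total_nil addr0 // addrC. Qed.

Lemma reidemeister_total T : reidemeister T ->
  {in T, forall t, total t.1 = total t.2}.
Proof.
have wp x p : weight (x, p) + weight (x, partner p) = 0.
  by case: p => [e|e|b]; rewrite /weight /= ?subrr ?addNr ?addr0.
have wf x y p : weight (x, p) + weight (y, flip p) = 0.
  by case: p => [[]|[]|b].
case=> [x p _|x b|x y e o|x y b o|x y z e1 e2 e3 o1 o2 o3 _|
    x y z b1 b2 b3 o1 o2 o3 _|x y z b1 b2 e3 o1 o2 o3 _] t;
  rewrite !in_cons in_nil orbF => tT.
- by rewrite (eqP tT) /= !total_cons total_nil addr0 wp.
- by rewrite (eqP tT) /= !total_cons total_nil addr0.
- case/orP: tT => /eqP-> /=; rewrite ?total_strand ?total_cons !total_nil ?addr0.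
    by rewrite wf.
  by case: e.
- by case/orP: tT => /eqP-> /=; rewrite ?total_strand ?total_cons !total_nil.
- by case/or3P: tT => /eqP-> /=; rewrite !total_strand.
- by case/or3P: tT => /eqP-> /=; rewrite !total_strand.
- by case/or3P: tT => /eqP-> /=; rewrite !total_strand.
Qed.

(** A lower bound, since the names in a [reidemeister] pattern may coincide. Against the upper bound
    [separated], it keeps the names of the strands out of the gaps. *)
Definition doubled (w : word) :=
  all (fun l : letter => 2 <= count (fun m : letter => m.1 == l.1) w)%N w.

Lemma reidemeister_doubled T : reidemeister T ->
  doubled (flatten (unzip1 T)) /\ doubled (flatten (unzip2 T)).
Proof.
have tri x y z px py pz o1 o2 o3 :
    doubled (flatten (unzip1 (triangle x y z px py pz o1 o2 o3))) /\
    doubled (flatten (unzip2 (triangle x y z px py pz o1 o2 o3))).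
  rewrite /doubled; case: o1; case: o2; case: o3; split;
    rewrite /= !eqxx; do ?[apply/andP; split=> //]; lia.
case=> // [x p _|x b|x y e o|x y b o]; split=> //; rewrite /doubled.
- by rewrite /= eqxx.
- by rewrite /= eqxx.
- by case: o; rewrite /= !eqxx; do ?[apply/andP; split=> //]; lia.
- by case: o; rewrite /= !eqxx; do ?[apply/andP; split=> //]; lia.
Qed.

Definition separated (M : seq (letter * int)) :=
  forall n, (count (fun u => u.1.1 == n) M <= 2)%N.

Lemma separated_decorate a w : well_formed w -> separated (decorate a w).
Proof.
move=> /allP wf n.
have -> : count (fun u : letter * int => u.1.1 == n) (decorate a w) =
    count (fun l : letter => l.1 == n) w.
  by rewrite -[in RHS](unzip1_decorate a w) count_map.
have [/hasP[l lw /eqP <-]|] := boolP (has (fun l : letter => l.1 == n) w).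
  by have /andP[/eqP->] := wf _ lw.
by rewrite has_count -leqNgt => /leq_trans->.
Qed.

Lemma separated_catr M N : separated (M ++ N) -> separated N.
Proof. by move=> sep n; apply: leq_trans (sep n); rewrite count_cat leq_addl. Qed.

Lemma gauss_sum_separated (V : zmodType) (psi : bool -> int -> V) M N :
  separated (M ++ N) -> doubled (unzip1 N) ->
  gauss_sum psi (M ++ N) = gauss_sum psi M + gauss_sum psi N.
Proof.
move=> sep /allP two; apply: gauss_sum_cat => u h uM hN; apply/eqP => uh.
have c1 : (0 < count (fun u : letter * int => u.1.1 == h.1.1) M)%N.
  by rewrite -has_count; apply/hasP; exists u; rewrite ?uh.
have c2 := two h.1 (map_f _ hN); rewrite /= count_map in c2.
have c3 := sep h.1.1; rewrite count_cat in c3.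
by have := leq_trans (leq_add c1 c2) c3.
Qed.

(** * Invariance of arrow sums under the moves *)

Section Invariance.

Variables (V : zmodType) (psi : bool -> int -> V).
Hypothesis psi0 : forall e, psi e 0 = 0.
Hypothesis psiN : forall e i, psi (~~ e) i = - psi e i.

(** Whichever end comes first, the head lies higher than the tail by the sign, so the index is 0. *)
Lemma gauss_sum_kink a x p :
  gauss_sum psi (decorate a [:: (x, p); (x, partner p)]) = 0.
Proof.
rewrite /gauss_sum /pair_sum !big_cons !big_nil /arrow_term /weight.
case: p => [e|e|b] /=; rewrite ?eqxx ?addr0 ?add0r ?addr0 //.
  by rewrite -[X in psi _ X](_ : 0 = _) ?psi0 //; lia.
by rewrite -[X in psi _ X](_ : 0 = _) ?psi0 //; lia.
Qed.

(** For [p = Over e], with w the sign of [x], both indices are [b - a - w] if [o] holds and [b - a]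
    otherwise; for [Under e], exchange [a] and [b]. The signs are opposite, so the terms cancel. *)
Lemma gauss_sum_bigon a b x y p o : x != y ->
  gauss_sum psi (decorate a [:: (x, p); (y, flip p)] ++
                 decorate b (strand o (x, partner p) (y, partner (flip p)))) = 0.
Proof.
move=> /negPf xy; have yx : (y == x) = false by rewrite eq_sym.
rewrite (perm_gauss_sum _ (perm_cat (perm_refl _) (perm_decorate_strand b o _ _))).
rewrite /gauss_sum /pair_sum !big_cons !big_nil /arrow_term /weight /=.
case: p => [e|e|c] /=; rewrite ?xy ?yx ?eqxx /= ?addr0 ?add0r ?addr0 //.
  rewrite psiN; apply/eqP; rewrite subr_eq0; apply/eqP; congr (psi _ _).
  by case: o e => -[]; rewrite /writhe /=; lia.
rewrite psiN; apply/eqP; rewrite subr_eq0; apply/eqP; congr (psi _ _).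
by case: o e => -[]; rewrite /writhe /=; lia.
Qed.

(** The letters are listed in a fixed order, so the two sides of a triangle move differ only in
    heights. *)
Definition triangle_slots a b c x y z px py pz o1 o2 o3 : seq (letter * int) :=
  let slot o l m d : seq (letter * int) :=
    [:: (l, d + if o then 0 else weight m); (m, d + if o then weight l else 0)] in
  slot o1 (x, px) (y, py) a ++ slot o2 (x, partner px) (z, pz) b ++
  slot o3 (y, partner py) (z, partner pz) c.

Lemma perm_triangle_slots a b c x y z px py pz o1 o2 o3 :
  perm_eq (decorate a (strand o1 (x, px) (y, py)) ++
           decorate b (strand o2 (x, partner px) (z, pz)) ++
           decorate c (strand o3 (y, partner py) (z, partner pz)))
    (triangle_slots a b c x y z px py pz o1 o2 o3).
Proof. by rewrite !perm_cat ?perm_decorate_strand. Qed.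

(** Each index depends on which of the other two crossings precede its ends on their strands.
    Reversing the strands changes both heights equally: for [x], [y], [z] this is the third, second
    and first condition of [triangular] respectively. *)
Lemma triangle_slots_omega3 a b c x y z e1 e2 e3 o1 o2 o3 :
  uniq [:: x; y; z] -> triangular (Over e1) (Over e2) (Over e3) o1 o2 o3 ->
  gauss_sum psi (triangle_slots a b c x y z (Over e1) (Over e2) (Over e3) o1 o2 o3)
  = gauss_sum psi (triangle_slots a b c x y z (Over e1) (Over e2) (Over e3)
                     (~~ o1) (~~ o2) (~~ o3)).
Proof.
rewrite /= !inE negb_or andbT => /andP[/andP[/negPf xy /negPf xz] /negPf yz] tri.
have [yx zx zy] : [/\ y == x = false, z == x = false & z == y = false].
  by rewrite ![_ == x]eq_sym [z == y]eq_sym.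
rewrite /gauss_sum /pair_sum /triangle_slots /= !big_cons !big_nil
  /arrow_term /weight /=.
rewrite ?xy ?xz ?yz ?yx ?zx ?zy ?eqxx /= ?addr0 ?add0r ?addr0.
rewrite /triangular /= in tri; rewrite /writhe /=.
by congr (psi _ _ + (psi _ _ + psi _ _)); move: tri;
  case: o1; case: o2; case: o3; case: e1; case: e2; case: e3; rewrite //=; lia.
Qed.

(** Serves [Omega3'] and [Omega3s]: only [z] can carry an arrow, and the crossings [x], [y] met on
    its strands weigh 0, so its ends keep their heights. *)
Lemma triangle_slots_virtual a b c x y z b1 b2 p o1 o2 o3 :
  gauss_sum psi (triangle_slots a b c x y z (Virt b1) (Virt b2) p o1 o2 o3)
  = gauss_sum psi (triangle_slots a b c x y z (Virt b1) (Virt b2) p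
                     (~~ o1) (~~ o2) (~~ o3)).
Proof.
have w0 n d : weight (n, Virt d) = 0 by [].
rewrite /gauss_sum /pair_sum /triangle_slots /= !big_cons !big_nil
  /arrow_term /= !w0.
by case: p => [e|e|d] //=; rewrite !if_same.
Qed.

Lemma gauss_sum_strands T U : reidemeister T -> unzip2 U = T ->
  separated (strands_before U) -> separated (strands_after U) ->
  gauss_sum psi (strands_before U) = gauss_sum psi (strands_after U).
Proof.
have nil0 : gauss_sum psi [::] = 0 by rewrite /gauss_sum /pair_sum big_nil.
have bigon_case x y p o W : unzip2 W = bigon x y p o ->
    separated (strands_after W) ->
    gauss_sum psi (strands_before W) = gauss_sum psi (strands_after W).
  case: W => [|[a t] [|[b t'] [|]]] //= -[-> ->].
  rewrite /strands_before /strands_after /= cats0 nil0 => sep.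
  (* If [x] and [y] coincided, this name would occur four times in the bigon. *)
  rewrite gauss_sum_bigon //; apply/eqP => xy; have := sep x.
  by rewrite xy; case: o {sep} => /=; rewrite !eqxx.
have triangle_perm W x y z px py pz o1 o2 o3 :
    unzip2 W = triangle x y z px py pz o1 o2 o3 ->
    exists a b c,
    perm_eq (strands_before W) (triangle_slots a b c x y z px py pz o1 o2 o3) /\
    perm_eq (strands_after W)
      (triangle_slots a b c x y z px py pz (~~ o1) (~~ o2) (~~ o3)).
  case: W => [|[a t] [|[b t'] [|[c t''] [|]]]] //= -[-> -> ->].
  by exists a, b, c; rewrite /strands_before /strands_after /= !cats0; split;
    exact: perm_triangle_slots.
case=> [x p _|x b|x y e o|x y b o|x y z e1 e2 e3 o1 o2 o3 tri|
    x y z b1 b2 b3 o1 o2 o3 _|x y z b1 b2 e3 o1 o2 o3 _].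
- case: U => [|[a t] [|]] //= -[->] _ _.
  by rewrite /strands_before /strands_after /= nil0 gauss_sum_kink.
- case: U => [|[a t] [|]] //= -[->] _ _.
  by rewrite /strands_before /strands_after /= nil0 gauss_sum_kink.
- by move=> /bigon_case + _; apply.
- by move=> /bigon_case + _; apply.
- move=> /triangle_perm[a [b [c [p p']]]] sep _.
  rewrite (perm_gauss_sum _ p) (perm_gauss_sum _ p') triangle_slots_omega3 //.
  have sep' n : (count (fun u => u.1.1 == n)
      (triangle_slots a b c x y z (Over e1) (Over e2) (Over e3) o1 o2 o3) <= 2)%N.
    by rewrite -(permP p); exact: sep.
  rewrite /= !inE negb_or andbT -andbA; apply/and3P; split; apply/eqP => E.
  + by have := sep' x; rewrite E /= !eqxx; lia.
  + by have := sep' x; rewrite E /= !eqxx; lia.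
  + by have := sep' y; rewrite E /= !eqxx; lia.
- move=> /triangle_perm[a [b [c [p p']]]] _ _.
  by rewrite (perm_gauss_sum _ p) (perm_gauss_sum _ p') triangle_slots_virtual.
- move=> /triangle_perm[a [b [c [p p']]]] _ _.
  by rewrite (perm_gauss_sum _ p) (perm_gauss_sum _ p') triangle_slots_virtual.
Qed.

(** The decorated gaps [M] are common to both sides and share no crossing with the strands, so the
    sums split and only the strands remain to be compared. *)
Lemma gauss_sum_move (D D' : diagram) (T T' : tangle_move) gaps :
  reidemeister T -> perm_eq T T' -> size gaps = size T ->
  D = join (unzip1 T') gaps :> word -> D' = join (unzip2 T') gaps :> word ->
  gauss_sum psi (decorate 0 D) = gauss_sum psi (decorate 0 D').
Proof.
move=> rT pT sz eD eD'.
have totT : {in T', forall t, total t.1 = total t.2}.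
  by move=> t; rewrite -(perm_mem pT); apply: reidemeister_total.
have [|U' [eU' [M []]]] := decorate_join 0 _ totT (gaps := gaps).
  by rewrite sz (perm_size pT).
rewrite -eD -eD' => p p'.
have [|U eU pU] := @perm_unzip2 _ _ U' T; first by rewrite eU'.
have pb : perm_eq (M ++ strands_before U') (M ++ strands_before U).
  by rewrite perm_cat2l perm_flatten // perm_map.
have pa : perm_eq (M ++ strands_after U') (M ++ strands_after U).
  by rewrite perm_cat2l perm_flatten // perm_map.
have {}p := perm_trans p pb; have {}p' := perm_trans p' pa.
have sep : separated (M ++ strands_before U).
  by move=> n; rewrite -(permP p); apply/separated_decorate/code_well_formed.
have sep' : separated (M ++ strands_after U).
  by move=> n; rewrite -(permP p'); apply/separated_decorate/code_well_formed.
have [dbl dbl'] := reidemeister_doubled rT.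
rewrite (perm_gauss_sum _ p) (perm_gauss_sum _ p') !gauss_sum_separated //.
- congr (_ + _); apply: gauss_sum_strands rT eU _ _.
    exact: separated_catr sep.
  exact: separated_catr sep'.
- by rewrite unzip1_strands_after eU.
- by rewrite unzip1_strands_before eU.
Qed.

Lemma arrow_sum_rot n g : gauss_word g -> arrow_sum psi (rot n g) = arrow_sum psi g.
Proof.
move=> gg; rewrite /arrow_sum (perm_big (arrows g)); last first.
  by apply: perm_pmap; rewrite perm_rot.
by apply: eq_big_seq => c cg; rewrite height_index_rot.
Qed.

(** Weights, hence heights, read only the passage of a letter and not its name. *)
Lemma arrow_sum_rename h g : injective h ->
  arrow_sum psi [seq (h l.1, l.2) | l <- g] = arrow_sum psi g.
Proof.
move=> hI; set r := fun l : letter => (h l.1, l.2).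
have rI : injective r by case=> x p [y q] [/hI-> ->].
have heightr l : height (map r g) (r l) = height g l.
  rewrite /height index_map // -map_take /total big_map.
  by apply: eq_bigr => -[x [e|e|b]].
have -> : arrow_sum psi (map r g) =
    \sum_(c <- arrows g) psi c.2 (height_index (map r g) (h c.1, c.2)).
  rewrite /arrow_sum -(big_map (fun c => (h c.1, c.2)) xpredT
    (fun c => psi c.2 (height_index (map r g) c))); congr bigop.
  by elim: g {heightr} => //= -[x [e|e|b]] g IH //=; rewrite IH.
apply: eq_bigr => -[x e] _; rewrite /height_index.
by rewrite -(heightr (x, Over e)) -(heightr (x, Under e)).
Qed.

Lemma arrow_sum_step (D D' : diagram) : step D D' ->
  arrow_sum psi (gauss D) = arrow_sum psi (gauss D').
Proof.
have wf E := code_well_formed E.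
case=> [n ->|h hI ->|T T' gaps rT pT sz eD eD'].
- have gg := gauss_word_gauss (wf D).
  (* The Gauss word is rotated by the number of classical letters among the first [n]. *)
  rewrite /rot /gauss filter_cat -!/(gauss _).
  have -> : gauss D = gauss (take n (code D)) ++ gauss (drop n (code D)).
    by rewrite /gauss -filter_cat cat_take_drop.
  rewrite -(arrow_sum_rot (size (gauss (take n (code D))))) ?rot_size_cat //.
  by rewrite /gauss -filter_cat cat_take_drop.
- by rewrite /gauss filter_map arrow_sum_rename.
rewrite -!gauss_sum_arrows //; exact: gauss_sum_move rT pT sz eD eD'.
Qed.

Lemma arrow_sum_equivalent (D D' : diagram) : equivalent D D' ->
  arrow_sum psi (gauss D) = arrow_sum psi (gauss D').
Proof.
elim=> [{}D {}D' /arrow_sum_step //|//|{}D {}D' _ -> //|D1 D2 D3 _ -> _ //].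
Qed.

End Invariance.

(** * Specialization to the polynomials *)

Definition odd_term (k : nat) (e : bool) (i : int) : laurent :=
  if (i == 2 ^+ k %[mod 2 ^+ k.+1])%Z then << writhe (0, e) *g i + 1 >> else 0.

(** Otherwise [2 ^+ k.+1] would divide [2 ^+ k], and cancelling [2 ^+ k] would make -1 even. *)
Lemma odd_term0 k e : odd_term k e 0 = 0.
Proof.
rewrite /odd_term; case: ifP => //; rewrite eqz_mod_dvd sub0r => /dvdzP[q].
rewrite exprS mulrA -mulN1r => /mulIf; rewrite expf_eq0 andbF; lia.
Qed.

Lemma odd_termN k e i : odd_term k (~~ e) i = - odd_term k e i.
Proof.
rewrite /odd_term; case: ifP => _; rewrite ?oppr0 // -monalgUN.
by case: e; rewrite /writhe /= ?opprK.
Qed.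

(** The residue test of [Odd] becomes the case distinction in [odd_term]. *)
Lemma f_polyE k D : f_poly k D = arrow_sum (odd_term k) (gauss D).
Proof.
have gg := gauss_word_gauss (code_well_formed D).
rewrite /f_poly /Odd big_filter big_mkcond; apply: eq_big_seq => c cg.
by rewrite index_arrowE // assigned_integerE.
Qed.

Theorem theorem3p3 :
  (forall (k : nat) (D D' : diagram), equivalent D D' -> f_poly k D = f_poly k D') /\
  (forall D D' : diagram,
     equivalent D D' -> writhe_polynomial D = writhe_polynomial D').
Proof.
have inv k D D' : equivalent D D' -> f_poly k D = f_poly k D'.
  by rewrite !f_polyE; apply: arrow_sum_equivalent;
    [exact: odd_term0|exact: odd_termN].
split=> // D D' eqD; rewrite /writhe_polynomial.
by apply: eq_fsbigr => k _; apply: inv.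
Qed.
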